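(* Let $d\ge 2$ be an integer, let $f:\mathbb{N}\to\mathbb{N}$ be a function of subexponential growth, and let $\{G_n\}_{n=1}^\infty\subset \mathrm{Graph}_d^f$ be a weakly convergent sequence of finite graphs. Then for any $\epsilon>0$ there exist a constant $K>0$ and, for every connected simple graph $H\in \mathrm{Graph}_d^f$ with $|V(H)|\le K$, a real constant $c_H$ such that for every $n\ge 1$ one can remove at most $\epsilon|E(G_n)|$ edges from $G_n$ so that, denoting by $G_n'$ the remaining graph (on the same vertex set), the following conditions are satisfied: (1) the number of vertices in each component of $G_n'$ is not greater than $K$; (2) if $V_H^n\subseteq V(G_n)$ is the set of vertices that are contained in a component of $G_n'$ isomorphic to $H$, then for every connected simple graph $H\in \mathrm{Graph}_d^f$ with $|V(H)|\le K$, $$\lim_{n\to\infty}\frac{|V_H^n|}{|V(G_n)|}=c_H .$$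
   Context: $\mathrm{Graph}_d$ is the set of finite simple graphs (up to isomorphism) in which every vertex has degree at most $d$. For a vertex $x$ of a graph, $B_r(x)$ is the ball of radius $r$ around $x$ (the vertices at graph distance at most $r$ from $x$ with the induced graph structure, rooted at $x$); $|B_r(x)|$ is its number of vertices. A function $f:\mathbb{N}\to\mathbb{N}$ has subexponential growth if for every $\delta>0$ there is $C_\delta>0$ such that $f(n)\le C_\delta(1+\delta)^n$ for all $n\ge1$. $\mathrm{Graph}_d^f$ is the class of graphs $G\in\mathrm{Graph}_d$ such that $|B_r(x)|\le f(r)$ for each $x\in V(G)$ and each $r\ge 1$. For $r\ge1$, $U^{r,d}$ denotes the finite set of rooted isomorphism classes of rooted $(r,d)$-balls, i.e. finite simple connected graphs of maximum degree at most $d$ with a distinguished root such that every vertex is at distance at most $r$ from the root. For $\alpha\in U^{r,d}$ and a finite graph $G\in \mathrm{Graph}_d$, $T(G,\alpha)$ is the set of $x\in V(G)$ such that $B_r(x)$ is rooted isomorphic to $\alpha$, and $p_G(\alpha)=|T(G,\alpha)|/|V(G)|$. A sequence $\{G_n\}\subset\mathrm{Graph}_d$ with $|V(G_n)|\to\infty$ is weakly convergent if $\lim_{n\to\infty}p_{G_n}(\alpha)$ exists for every $r\ge1$ and $\alpha\in U^{r,d}$. *)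

(* Defs.v *)
From HB Require Import structures.
From mathcomp Require Import all_boot all_order all_algebra.
From mathcomp Require Import boolp classical_sets reals topology normedtype sequences.

Set Implicit Arguments.
Unset Strict Implicit.
Unset Printing Implicit Defensive.

Import Order.TTheory GRing.Theory Num.Theory.
Import numFieldNormedType.Exports.

Local Open Scope ring_scope.

Record sgraph := SGraph {
  vertex :> finType;
  adj : rel vertex;
  adj_sym : symmetric adj;
  adj_irr : irreflexive adj }.

Arguments adj {s} : rename.

(* The edge {x, y} is represented by the two-element set [set x; y]. *)
Definition edges (G : sgraph) : {set {set G}} :=
  [set [set p.1; p.2] | p : G * G & adj p.1 p.2].

Definition degree (G : sgraph) (x : G) : nat := #|[set y | adj x y]|.

(* y is at graph distance at most r from x: some walk of length at most r
   leads from x to y. *)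
Definition dist_le (G : sgraph) (r : nat) (x y : G) : Prop :=
  exists p : seq G, [/\ path adj x p, last x p = y & (size p <= r)%N].

Definition gball (G : sgraph) (r : nat) (x : G) : {set G} :=
  [set y | `[< dist_le r x y >]].

Lemma gball_center (G : sgraph) (r : nat) (x : G) : x \in gball r x.
Proof. by rewrite inE; apply/asboolP; exists [::]. Qed.

Definition connected_graph (G : sgraph) : Prop :=
  (0 < #|G|)%N /\ forall x y : G, connect adj x y.

Section Induced.
Variables (G : sgraph) (A : {set G}).

Definition induced_adj : rel {x : G | x \in A} :=
  fun x y => adj (val x) (val y).

Lemma induced_adj_sym : symmetric induced_adj.
Proof. by move=> x y; rewrite /induced_adj adj_sym. Qed.

Lemma induced_adj_irr : irreflexive induced_adj.
Proof. by move=> x; rewrite /induced_adj adj_irr. Qed.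

Definition induced : sgraph := SGraph induced_adj_sym induced_adj_irr.
End Induced.

Definition graph_iso (G H : sgraph) : Prop :=
  exists h : G -> H, bijective h /\ {mono h : x y / adj x y}.

Record rgraph := RGraph { rgraph_graph :> sgraph; root : rgraph_graph }.

Definition rooted_iso (A B : rgraph) : Prop :=
  exists h : A -> B,
    [/\ bijective h, {mono h : x y / adj x y} & h (root A) = root B].

Definition rooted_ball (G : sgraph) (r : nat) (x : G) : rgraph :=
  @RGraph (induced (gball r x)) (Sub x (gball_center r x)).

Definition max_degree_le (d : nat) (G : sgraph) : Prop :=
  forall x : G, (degree x <= d)%N.

Definition in_Graph_df (d : nat) (f : nat -> nat) (G : sgraph) : Prop :=
  max_degree_le d G /\
  forall (x : G) (r : nat), (1 <= r)%N -> (#|gball r x| <= f r)%N.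

Definition subexponential (R : realType) (f : nat -> nat) : Prop :=
  forall delta : R, 0 < delta ->
    exists2 C : R, 0 < C &
      forall n : nat, (1 <= n)%N -> (f n)%:R <= C * (1 + delta) ^+ n.

(* Rooted isomorphism classes are handled through their representatives:
   everything below depends on alpha only up to rooted isomorphism. *)
Definition is_rd_ball (r d : nat) (alpha : rgraph) : Prop :=
  [/\ connected_graph alpha, max_degree_le d alpha
    & forall x : alpha, dist_le r (root alpha) x].

Definition ball_type_set (G : sgraph) (r : nat) (alpha : rgraph) : {set G} :=
  [set x | `[< rooted_iso (rooted_ball r x) alpha >]].

Definition ball_freq (R : realType) (G : sgraph) (r : nat) (alpha : rgraph) : R :=
  #|ball_type_set G r alpha|%:R / #|G|%:R.

Definition weakly_convergent (R : realType) (d : nat) (G : nat -> sgraph) : Prop :=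
  ((fun n => #|G n|) @ \oo --> \oo)%classic /\
  forall (r : nat) (alpha : rgraph), (1 <= r)%N -> is_rd_ball r d alpha ->
    exists l : R, ((fun n => ball_freq R (G n) r alpha) @ \oo --> l)%classic.

Section RemoveEdges.
Variables (G : sgraph) (S : {set {set G}}).

Definition remove_adj : rel G :=
  fun x y => adj x y && ([set x; y] \notin S).

Lemma remove_adj_sym : symmetric remove_adj.
Proof. by move=> x y; rewrite /remove_adj adj_sym finset.setUC. Qed.

Lemma remove_adj_irr : irreflexive remove_adj.
Proof. by move=> x; rewrite /remove_adj adj_irr. Qed.

Definition remove_edges : sgraph := SGraph remove_adj_sym remove_adj_irr.
End RemoveEdges.

Definition component (G : sgraph) (x : G) : {set G} := [set y | connect adj x y].

Definition component_type_set (G H : sgraph) : {set G} :=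
  [set x : G | `[< graph_iso (induced (component x)) H >]].

(* Main.v *)
Require Import Defs.
From HB Require Import structures.
From mathcomp Require Import all_boot all_order all_algebra.
From mathcomp Require Import boolp classical_sets reals topology normedtype sequences.
From mathcomp Require Import zify ring lra fintype finset.

Set Implicit Arguments.
Unset Strict Implicit.
Unset Printing Implicit Defensive.

Import Order.TTheory GRing.Theory Num.Theory.
Import numFieldNormedType.Exports.
Import Defs.

(* Label the vertices independently and uniformly by [0, ..., M].  In round [i]
   every not yet carved vertex [c] of label [i] carves out the ball of least
   radius [k <= r] around itself, taken in the graph of uncarved vertices, whose
   edge boundary is at most [1/t] times its number of inner edges; subexponential
   growth makes such a radius exist.  Vertices sharing their label with another
   vertex within distance [2 r] do not carve, which keeps the balls of one round
   disjoint; they are rare when [M] is large.  Removing all edges not inside a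
   carved ball costs few edges, relative to the number of edges.  The component of
   a vertex depends only on the isomorphism class of the labelled ball of some
   fixed radius around it.  So the expected number of vertices in components of a
   given type is a combination of ball frequencies, which converge, and its
   variance is linear in the number of vertices.  Averaging yields a labelling that
   meets the edge bound and is close to the expectation for all types at once. *)

(** * Balls, layers and edge boundaries *)

Section Balls.
Variable G : sgraph.
Implicit Types (x y z u v : G) (r k : nat).

Lemma gballP r x y : reflect (dist_le r x y) (y \in gball r x).
Proof. by rewrite inE; exact: asboolP. Qed.

Lemma gball0 x y : (y \in gball 0 x) = (y == x).
Proof.
apply/idP/eqP => [/gballP[[|z p]] [_ <- //]|->]; exact: gball_center.
Qed.

Lemma gball_trans r k x y z :
  y \in gball r x -> z \in gball k y -> z \in gball (r + k) x.
Proof.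
move=> /gballP[p [xp yp rp]] /gballP[q [yq zq rq]]; apply/gballP.
exists (p ++ q); rewrite cat_path last_cat size_cat yp xp yq leq_add //; split=> //.
Qed.

Lemma gball_sym r x y : (y \in gball r x) = (x \in gball r y).
Proof.
suff aux u v : v \in gball r u -> u \in gball r v by apply/idP/idP; exact: aux.
move=> /gballP[p [up vp rp]]; apply/gballP.
exists (rev (belast u p)); split.
- rewrite -vp rev_path; apply: sub_path up => a b /=; by rewrite adj_sym.
- case: p up vp rp => [//|w p] _ _ _; by rewrite /= rev_cons last_rcons.
- by rewrite size_rev size_belast.
Qed.

Lemma gball_mono r k x : r <= k -> {subset gball r x <= gball k x}.
Proof.
by move=> rk y /gballP[p [xp yp rp]]; apply/gballP; exists p; split=> //; apply: leq_trans rk.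
Qed.

Lemma gball_adj r x y z : y \in gball r x -> adj y z -> z \in gball r.+1 x.
Proof.
move=> yx yz; rewrite -addn1; apply: (gball_trans yx).
by apply/gballP; exists [:: z]; rewrite /= yz.
Qed.

Lemma gballS r x y :
  (y \in gball r.+1 x) = (y \in gball r x) || [exists z in gball r x, adj z y].
Proof.
apply/idP/idP => [/gballP[p]|/orP[|/existsP[z /andP[zx zy]]]]; last 2 first.
- exact: gball_mono.
- exact: gball_adj zx zy.
case/lastP: p => [[_ <- _]|p w]; first by rewrite gball_center.
rewrite rcons_path last_rcons size_rcons ltnS => -[/andP[xp pw] wy pr].
rewrite -wy; apply/orP; right; apply/existsP; exists (last x p).
by rewrite pw andbT; apply/gballP; exists p.
Qed.

(* The ball of radius [k] around [c] in the graph induced on [c |: U]. *)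
Definition layer (U : {set G}) c k : {set G} :=
  locked (iter k (fun A => A :|: [set y in U | [exists z in A, adj z y]]) [set c]).

Lemma layer0 U c : layer U c 0 = [set c].
Proof. by rewrite /layer -lock. Qed.

Lemma layerS U c k y : (y \in layer U c k.+1) =
  (y \in layer U c k) || ((y \in U) && [exists z in layer U c k, adj z y]).
Proof. by rewrite /layer -!lock /= !inE. Qed.

Lemma gball_layer r x : gball r x = layer setT x r.
Proof.
elim: r => [|r IH]; apply/setP=> y; first by rewrite layer0 gball0 inE.
by rewrite gballS layerS in_setT IH.
Qed.

Lemma layer_sub_gball U c k : layer U c k \subset gball k c.
Proof.
elim: k => [|k IH]; apply/subsetP=> y; first by rewrite layer0 gball0 inE.
rewrite layerS => /orP[/(subsetP IH)|/andP[_ /existsP[z /andP[/(subsetP IH) zc zy]]]].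
- exact: gball_mono.
- exact: gball_adj zc zy.
Qed.

Lemma layer_sub (U : {set G}) c k : c \in U -> layer U c k \subset U.
Proof.
move=> cU; elim: k => [|k IH]; first by rewrite layer0 sub1set.
by apply/subsetP=> y; rewrite layerS => /orP[/(subsetP IH)|/andP[]].
Qed.

Lemma layer_center U c k : c \in layer U c k.
Proof. by elim: k => [|k IH]; [rewrite layer0 set11 | rewrite layerS IH]. Qed.

(** Edges are counted as ordered pairs: inner edges twice, boundary edges once, oriented
    outwards. *)
Definition inner (A : {set G}) : {set G * G} :=
  [set p | [&& p.1 \in A, p.2 \in A & adj p.1 p.2]].

Definition bdry (U A : {set G}) : {set G * G} :=
  [set p | [&& p.1 \in A, p.2 \in U :\: A & adj p.1 p.2]].

Lemma in_inner A x y : ((x, y) \in inner A) = [&& x \in A, y \in A & adj x y].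
Proof. by rewrite inE. Qed.

Lemma in_bdry U A x y :
  ((x, y) \in bdry U A) = [&& x \in A, y \in U, y \notin A & adj x y].
Proof. by rewrite inE /= in_setD; case: (y \in A); rewrite /= ?andbF. Qed.

(** A boundary edge of a layer ends at a vertex of [U] adjacent to that layer, so the next layer
    contains it; boundary pairs and inner pairs are disjoint, so their numbers add up. *)
Lemma inner_layerS U c k :
  #|inner (layer U c k)| + #|bdry U (layer U c k)| <= #|inner (layer U c k.+1)|.
Proof.
have dis : inner (layer U c k) :&: bdry U (layer U c k) = set0.
  apply/setP=> -[a b]; rewrite in_setI in_inner in_bdry in_set0.
  by case: (b \in layer _ _ _); rewrite !andbF.
rewrite -cardsUI dis cards0 addn0.
apply/subset_leq_card/subsetP => -[a b].
rewrite in_setU !in_inner in_bdry !layerS.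
case/orP=> [/and3P[-> -> ->] //|/and4P[ha -> _ ab]].
rewrite ha ab andbT /=; apply/orP; right; apply/existsP; exists a; exact/andP.
Qed.

Lemma card_inner_le d A : max_degree_le d G -> #|inner A| <= d * #|A|.
Proof.
move=> Gd; rewrite -sum1dep_card (eq_bigl (fun p : G * G => (p.1 \in A) && ((p.2 \in A) && adj p.1 p.2))) //.
rewrite -(pair_big_dep (mem A) (fun x y => (y \in A) && adj x y) (fun _ _ => 1)) /=.
rewrite mulnC -sum_nat_const; apply: leq_sum => x _.
rewrite sum1dep_card; apply: leq_trans (Gd x); apply/subset_leq_card/subsetP=> y.
by rewrite !inE => /andP[].
Qed.

End Balls.

Lemma set2_eq (T : finType) (a b x y : T) :
  [set a; b] = [set x; y] -> (a = x /\ b = y) \/ (a = y /\ b = x).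
Proof.
move=> E.
have : a \in [set x; y] by rewrite -E set21.
have : b \in [set x; y] by rewrite -E set22.
have : x \in [set a; b] by rewrite E set21.
have : y \in [set a; b] by rewrite E set22.
by rewrite !inE; do 4![case/orP=> /eqP ?]; subst; auto.
Qed.

(** * The carving process and the number of edges it cuts *)

Section Carving.
Variables (t R : nat) (G : sgraph).
Implicit Types (U : {set G}) (c x y : G) (ell : G -> nat).

Definition good U c k :=
  t * #|bdry U (layer U c k)| <= #|inner (layer U c k)|.

(** [find] returns [R.+1] when no radius is good, so a bound by [R.+1] is always available; the
    locality arguments rely on it. *)
Definition radius U c := find (good U c) (iota 0 R.+1).

Lemma radius_leS U c : radius U c <= R.+1.
Proof. by rewrite /radius -[leqRHS](size_iota 0 R.+1) find_size. Qed.

Definition lonely ell c :=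
  [forall y in gball (2 * R) c, (ell y == ell c) ==> (y == c)].

Definition cluster ell U c : {set G} :=
  if (c \in U) && lonely ell c then layer U c (radius U c) else set0.

Fixpoint rest ell i : {set G} :=
  if i is j.+1 then
    rest ell j :\: \bigcup_(c | ell c == j) cluster ell (rest ell j) c
  else setT.

Definition final_cluster ell c := cluster ell (rest ell (ell c)) c.

(** Not reflexive: a vertex outside all clusters is related to nothing, so it loses all its edges
    and becomes a component by itself. *)
Definition same ell x y :=
  [exists c, (x \in final_cluster ell c) && (y \in final_cluster ell c)].

Definition cut ell : {set {set G}} :=
  [set [set p.1; p.2] | p : G * G & adj p.1 p.2 && ~~ same ell p.1 p.2].

Lemma same_sym ell : symmetric (same ell).
Proof. by move=> x y; apply: eq_existsb => c; rewrite andbC. Qed.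

Lemma cut_sub ell : cut ell \subset edges G.
Proof.
by apply/subsetP=> e /imsetP[p /[!inE] /andP[ap _] ->]; apply: imset_f; rewrite inE.
Qed.

Lemma remove_cut_adj ell x y :
  @adj (remove_edges (cut ell)) x y = adj x y && same ell x y.
Proof.
rewrite /= /remove_adj; case xy: (adj x y) => //=.
apply/negP/idP => [ncut|sxy].
- apply: contraT => nsxy; case: ncut; apply/imsetP; exists (x, y) => //.
  by rewrite inE /= xy nsxy.
- case/imsetP=> -[a b] /[!inE] /= /andP[ab] nab /set2_eq[[E1 E2]|[E1 E2]].
  + by rewrite -E1 -E2 sxy in nab.
  + by rewrite -E1 -E2 same_sym sxy in nab.
Qed.

Lemma in_restS ell i x : (x \in rest ell i.+1) =
  (x \notin \bigcup_(c | ell c == i) cluster ell (rest ell i) c) && (x \in rest ell i).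
Proof. by rewrite in_setD. Qed.

Lemma rest_mono ell i j : i <= j -> rest ell j \subset rest ell i.
Proof.
elim: j => [|j IH]; first by rewrite leqn0 => /eqP->.
rewrite leq_eqVlt => /orP[/eqP-> //|/IH]; apply: subset_trans.
exact: subsetDl.
Qed.

Lemma final_cluster_sub_rest ell c : final_cluster ell c \subset rest ell (ell c).
Proof.
rewrite /final_cluster /cluster; case: ifP => [/andP[cU _]|_]; last exact: sub0set.
exact: layer_sub.
Qed.

Lemma final_cluster_notin_restS ell c x :
  x \in final_cluster ell c -> x \notin rest ell (ell c).+1.
Proof.
move=> xc; rewrite in_restS negb_and negbK; apply/orP; left.
by apply/bigcupP; exists c.
Qed.

Lemma final_cluster_center ell c x :
  x \in final_cluster ell c -> c \in rest ell (ell c) /\ lonely ell c.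
Proof. by rewrite /final_cluster /cluster; case: ifP => [/andP[]|]; rewrite ?inE. Qed.

Section SmallBoundary.
Hypothesis has_good : forall U c, exists2 k, k <= R & good U c k.

Lemma radius_le U c : radius U c <= R.
Proof.
have [k kR gk] := has_good U c; rewrite -ltnS -[ltnRHS](size_iota 0 R.+1) -has_find.
by apply/hasP; exists k; rewrite // mem_iota.
Qed.

Lemma good_radius U c : good U c (radius U c).
Proof.
have h : has (good U c) (iota 0 R.+1).
  by rewrite has_find size_iota ltnS; exact: radius_le.
have := nth_find 0 h; rewrite nth_iota //; first by rewrite ltnS; exact: radius_le.
Qed.

Lemma final_cluster_gball ell c : final_cluster ell c \subset gball R c.
Proof.
rewrite /final_cluster /cluster; case: ifP => [_|_]; last exact: sub0set.
apply: subset_trans (layer_sub_gball _ _ _) _; apply/subsetP.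
by apply: gball_mono; exact: radius_le.
Qed.

(** If the labels differ, the earlier cluster was deleted before the later one was carved. If they
    agree, both centres lie within [R] of [x], hence within [2 * R] of each other, and loneliness
    makes them equal. *)
Lemma final_cluster_inj ell c c' x :
  x \in final_cluster ell c -> x \in final_cluster ell c' -> c = c'.
Proof.
wlog le : c c' / ell c <= ell c' => [W xc xc'|xc xc'].
  by have [/W->|/ltnW/W->] := leqP (ell c) (ell c').
have := final_cluster_notin_restS xc.
have xr := subsetP (final_cluster_sub_rest ell c') _ xc'.
move: le; rewrite leq_eqVlt => /orP[/eqP E _|lt /negP[]]; last first.
  exact: (subsetP (rest_mono ell lt)).
have [_ /forall_inP L] := final_cluster_center xc.
have c'c : c' \in gball (2 * R) c.
  rewrite mul2n -addnn; apply: (@gball_trans _ _ _ _ x).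
  - exact: (subsetP (final_cluster_gball ell c)).
  - by rewrite gball_sym; exact: (subsetP (final_cluster_gball ell c')).
by have := L _ c'c; rewrite E eqxx /= => /eqP.
Qed.

Definition crowded ell : {set G} := [set c | ~~ lonely ell c].

(** A lonely vertex that survives until its own round carves a cluster containing itself. *)
Lemma lonely_notin_rest ell n x : (forall c, ell c < n) -> lonely ell x ->
  x \notin rest ell n.
Proof.
move=> elln lx; apply/negP => xr.
have xU := subsetP (rest_mono ell (ltnW (elln x))) _ xr.
have : x \in final_cluster ell x by rewrite /final_cluster /cluster xU lx layer_center.
move/final_cluster_notin_restS; apply/negP; rewrite negbK.
exact: (subsetP (rest_mono ell (elln x))).
Qed.

Lemma covered ell n x : (forall c, ell c < n) -> lonely ell x ->
  exists c, x \in final_cluster ell c.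
Proof.
move=> elln lx; have := lonely_notin_rest elln lx; elim: n {elln} => [|n IH]; first by rewrite in_setT.
rewrite in_restS negb_and negbK => /orP[/bigcupP[c /eqP cn]|/IH//].
by rewrite -cn => xc; exists c.
Qed.

(** A cut edge either has a crowded endpoint ([P2]) or joins two distinct clusters and lies in the
    boundary of one of them ([P1]). Each boundary is at most [1/t] of the inner pairs of its
    cluster, and these are disjoint for distinct clusters. *)
Lemma card_cut d ell n : max_degree_le d G -> (forall c, ell c < n) ->
  t * #|cut ell| <= #|inner (setT : {set G})| + t * (d * #|crowded ell|).
Proof.
move=> Gd elln.
pose P1 := \bigcup_c bdry (rest ell (ell c)) (final_cluster ell c).
pose P2 : {set G * G} := [set p | (p.1 \in crowded ell) && adj p.1 p.2].
have sub : cut ell \subset [set [set p.1; p.2] | p in P1 :|: P2].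
  apply/subsetP=> e /imsetP[[x y] /[!inE] /= /andP[xy nxy] ->].
  have [lx|nlx] := boolP (lonely ell x); last first.
    by apply/imsetP; exists (x, y) => //; apply/setUP; right; rewrite inE inE /= nlx.
  have [ly|nly] := boolP (lonely ell y); last first.
    rewrite finset.setUC; apply/imsetP; exists (y, x) => //; apply/setUP; right.
    by rewrite inE inE /= nly adj_sym.
  have [c xc] := covered elln lx; have [c' yc'] := covered elln ly.
  (* Orient the edge so that [x] is carved no later than [y]: then [y] is still uncarved in the
     round of [c], and the edge belongs to the boundary of the cluster of [c]. *)
  wlog le : x y c c' {lx ly} xy nxy xc yc' / ell c <= ell c'.
    move=> W; have [le|/ltnW le] := leqP (ell c) (ell c'); first exact: (W x y c c').
    by rewrite finset.setUC; apply: (W y x c' c) => //; rewrite 1?adj_sym 1?same_sym.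
  apply/imsetP; exists (x, y) => //; rewrite inE; apply/orP; left.
  apply/bigcupP; exists c => //; rewrite in_bdry xc xy andbT /=; apply/andP; split; last first.
    by apply/negP => yc; case/negP: nxy; apply/existsP; exists c; rewrite xc.
  apply: (subsetP (rest_mono ell le)); exact: (subsetP (final_cluster_sub_rest ell c')).
have le1 : #|cut ell| <= #|P1| + #|P2|.
  by apply: leq_trans (subset_leq_card sub) (leq_trans (leq_imset_card _ _) (leq_card_setU _ _)).
have le2 : #|P2| <= d * #|crowded ell|.
  rewrite -sum1dep_card -(pair_big_dep (mem (crowded ell)) (fun x y => adj x y) (fun _ _ => 1)) /=.
  by rewrite mulnC -sum_nat_const; apply: leq_sum => x _; rewrite sum1dep_card; exact: Gd.
have le3 : t * #|P1| <= #|inner (setT : {set G})|.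
  apply: (@leq_trans (\sum_c #|inner (final_cluster ell c)|)).
    apply: (@leq_trans (\sum_c t * #|bdry (rest ell (ell c)) (final_cluster ell c)|)).
      rewrite -big_distrr leq_mul2l /P1; apply/orP; right.
      elim/big_rec2: _ => [|c s A _ IH]; first by rewrite cards0.
      by apply: leq_trans (leq_card_setU _ _) _; rewrite leq_add2l.
    apply: leq_sum => c _; rewrite /final_cluster /cluster; case: ifP => _.
      exact: good_radius.
    rewrite (_ : bdry _ _ = set0) ?cards0 ?muln0 //.
    by apply/setP=> p; rewrite !inE.
  have dis : forall i j, i != j ->
      [disjoint inner (final_cluster ell i) & inner (final_cluster ell j)].
    move=> i j; apply: contraR => /pred0Pn[[a b] /andP[]].
    rewrite /= !in_inner => /and3P[pi _ _] /and3P[pj _ _].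
    by apply/eqP; exact: final_cluster_inj pi pj.
  have := partition_disjoint_bigcup addn (fun _ : G * G => 1) dis.
  rewrite sum1_card => E; under eq_bigr do rewrite -sum1_card.
  rewrite -E; apply/subset_leq_card/subsetP=> p /bigcupP[c _].
  by rewrite !inE => /and3P[_ _ ->].
by rewrite (leq_trans (leq_mul (leqnn t) le1)) // mulnDr leq_add // leq_mul2l le2 orbT.
Qed.

End SmallBoundary.
End Carving.

(** * Existence of a radius with small boundary *)

Section Growth.
Variables (t R : nat) (G : sgraph).

(** Passing a radius that is not good multiplies the number of inner pairs by at least
    [(t + 1) / t]; the first such radius has a nonempty boundary, which starts the induction. *)
Lemma inner_growth (U : {set G}) c k :
  (forall j, j <= k -> ~~ good t U c j) ->
  t.+1 ^ k <= t ^ k * #|inner (layer U c k.+1)|.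
Proof.
elim: k => [|k IH] ngood.
  have := ngood 0 isT; rewrite /good -ltnNge => h.
  rewrite !expn0 mul1n; apply: leq_trans (inner_layerS U c 0).
  have := leq_ltn_trans (leq0n _) h; rewrite muln_gt0 => /andP[_ b].
  by rewrite addn_gt0 b orbT.
have := IH (fun j jk => ngood j (leqW jk)).
have := ngood k.+1 (leqnn _); rewrite /good -ltnNge.
have := inner_layerS U c k.+1; rewrite 2!expnS.
move: #|inner _| #|bdry _ _| #|inner (layer U c k.+1)| => a2 b a1 ab atb qa.
have step : t.+1 * a1 <= t * a2 by nia.
apply: (@leq_trans (t ^ k * (t.+1 * a1))); first by rewrite mulnCA leq_mul2l qa orbT.
by rewrite (mulnC t) -mulnA leq_mul2l step orbT.
Qed.

(** Otherwise the growth would exceed [d * f R.+1], which bounds the inner pairs of any layer of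
    radius [R.+1]. *)
Lemma exists_good d f (U : {set G}) c :
  in_Graph_df d f G -> t ^ R * (d * f R.+1) < t.+1 ^ R ->
  exists2 k, k <= R & good t U c k.
Proof.
move=> [Gd Gf] big; apply: contrapT => H.
have ng j : j <= R -> ~~ good t U c j by move=> jR; apply/negP => g; apply: H; exists j.
have := leq_trans big (inner_growth ng); rewrite ltn_mul2l => /andP[_]; apply/negP.
rewrite -leqNgt; apply: leq_trans (card_inner_le _ Gd) _; rewrite leq_mul2l.
by rewrite (leq_trans (subset_leq_card (layer_sub_gball _ _ _)) (Gf _ _ _)) ?orbT.
Qed.
End Growth.

(** * Size and diameter of the components after cutting *)

Section Components.
Variables (t R : nat) (G : sgraph) (ell : G -> nat).
Hypothesis has_good : forall (U : {set G}) c, exists2 k, k <= R & good t U c k.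

Notation G1 := (remove_edges (cut t R ell)).

Lemma same_trans : transitive (same t R ell).
Proof.
move=> y x z /existsP[c /andP[xc yc]] /existsP[c' /andP[yc' zc']].
apply/existsP; exists c; rewrite xc (final_cluster_inj has_good yc yc').
by rewrite zc'.
Qed.

Lemma component_same (x y : G) :
  y \in @component G1 x -> y = x \/ same t R ell x y.
Proof.
rewrite inE => /connectP[p]; elim/last_ind: p y => [|p z IH] y; first by move=> _ ->; left.
rewrite rcons_path last_rcons => /andP[xp]; rewrite remove_cut_adj => /andP[_ s] ->.
by have [<-|/same_trans/(_ s)] := IH _ xp erefl; right.
Qed.

Lemma component_gball (x : G) : @component G1 x \subset gball (2 * R) x.
Proof.
apply/subsetP => y /component_same[->|/existsP[c /andP[xc yc]]]; first exact: gball_center.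
rewrite mul2n -addnn; apply: (@gball_trans _ _ _ _ c).
- by rewrite gball_sym; exact: (subsetP (final_cluster_gball has_good ell c)).
- exact: (subsetP (final_cluster_gball has_good ell c)).
Qed.

(** A component lies in a single cluster, hence in the ball of radius [R] around its centre, or is a
    single uncovered vertex. *)
Lemma card_component d f (x : G) : in_Graph_df d f G -> 0 < R ->
  #|@component G1 x| <= f R.
Proof.
move=> [_ Gf] R_gt0.
have [[c xc]|nc] := pselect (exists c, x \in final_cluster t R ell c).
  apply: leq_trans (Gf c R R_gt0); apply: subset_leq_card; apply/subsetP => y yx.
  apply: (subsetP (final_cluster_gball has_good ell c)).
  have [->//|/existsP[c' /andP[xc' yc']]] := component_same yx.
  by rewrite (final_cluster_inj has_good xc xc').
apply: leq_trans (Gf x R R_gt0); apply: subset_leq_card; apply/subsetP => y yx.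
have [->|/existsP[c /andP[xc _]]] := component_same yx; first exact: gball_center.
by case: nc; exists c.
Qed.
End Components.

(** * Locality: local isomorphisms preserve the carving *)

Section LocalIso.

(* [phi] and [psi] restrict to mutually inverse isomorphisms between the balls of
   radius [r] around [x] and [x']; their values elsewhere are irrelevant. *)
Record local_iso (G G' : sgraph) r (x : G) (x' : G') (phi : G -> G') (psi : G' -> G) : Prop :=
  LocalIso {
    liso_root : phi x = x';
    liso_rootV : psi x' = x;
    lisoK : {in gball r x, cancel phi psi};
    lisoVK : {in gball r x', cancel psi phi};
    liso_gball : forall y, y \in gball r x -> phi y \in gball r x';
    liso_gballV : forall y', y' \in gball r x' -> psi y' \in gball r x;
    liso_adj : {in gball r x &, forall y z, adj (phi y) (phi z) = adj y z} }.

Lemma local_iso_sym G G' r x x' phi psi :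
  @local_iso G G' r x x' phi psi -> @local_iso G' G r x' x psi phi.
Proof.
move=> [root rootV K VK ball ballV a]; split=> // y z yx zx.
by rewrite -a ?VK //; exact: ballV.
Qed.

Lemma local_iso_id (G : sgraph) r (x : G) : @local_iso G G r x x id id.
Proof. by []. Qed.

Lemma liso_gball_le G G' r x x' phi psi k y :
  @local_iso G G' r x x' phi psi -> k <= r -> y \in gball k x -> phi y \in gball k x'.
Proof.
move=> h; elim: k y => [|k IH] y kr; first by rewrite !gball0 => /eqP->; rewrite (liso_root h).
rewrite gballS => /orP[/(IH _ (ltnW kr))|]; first exact: gball_mono.
case/existsP=> z /andP[zx zy]; apply: (@gball_adj _ _ _ (phi z)); first exact: IH (ltnW kr) zx.
rewrite (liso_adj h) //; first exact: gball_mono (ltnW kr) _ zx.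
by apply: (gball_mono kr); exact: gball_adj zx zy.
Qed.

Section Transfer.
Variables (t R : nat).

(** [U] and [U'] will be the uncarved vertices of two graphs; the radius [k] of agreement shrinks
    from round to round. *)
Definition matched (G G' : sgraph) (x : G) (phi : G -> G') k (U : {set G}) (U' : {set G'}) :=
  forall y, y \in gball k x -> (phi y \in U') = (y \in U).

Lemma matched_sym (G G' : sgraph) r x x' phi psi k U U' :
  @local_iso G G' r x x' phi psi -> k <= r ->
  matched x phi k U U' -> matched x' psi k U' U.
Proof.
move=> h kr m y' yx'; rewrite -m ?(lisoVK h) //; first exact: gball_mono kr _ yx'.
exact: liso_gball_le (local_iso_sym h) kr yx'.
Qed.

Section Layers.
Variables (G G' : sgraph) (r : nat) (x : G) (x' : G') (phi : G -> G') (psi : G' -> G).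
Hypothesis h : local_iso r x x' phi psi.
Variables (m : nat) (U : {set G}) (U' : {set G'}).
Hypotheses (mr : m <= r) (mU : matched x phi m U U').

Lemma liso_inj y z : y \in gball r x -> z \in gball r x -> (phi y == phi z) = (y == z).
Proof.
move=> yx zx; apply/eqP/eqP => [E|->//].
by rewrite -(lisoK h yx) E (lisoK h zx).
Qed.

Lemma liso_nbr k y z' : k < r -> y \in gball k x -> adj z' (phi y) ->
  exists z, [/\ z \in gball k.+1 x, z' = phi z & adj z y].
Proof.
move=> kr yx zy; exists (psi z').
have zx' : z' \in gball k.+1 x'.
  apply: (@gball_adj _ _ _ (phi y)); last by rewrite adj_sym.
  exact: liso_gball_le h (ltnW kr) yx.
have zx := liso_gball_le (local_iso_sym h) kr zx'.
have z'K := lisoVK h (gball_mono kr zx').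
split=> //; rewrite -(liso_adj h) ?z'K //; first exact: gball_mono zx.
exact: gball_mono (ltnW kr) _ yx.
Qed.

(** The induction traces a walk back from [y] towards [c]: each step lowers [j] by one and may raise
    the distance [k] from [x] by one. *)
Lemma liso_layer c k j y : c \in gball r x -> y \in gball k x -> k + j <= m ->
  (phi y \in layer U' (phi c) j) = (y \in layer U c j).
Proof.
move=> cx; elim: j k y => [|j IH] k y yx kj.
  by rewrite !layer0 !inE liso_inj //; apply: gball_mono yx; lia.
rewrite !layerS (IH k) //; last lia.
rewrite (mU (gball_mono _ yx)); last lia.
congr (_ || (_ && _)); apply/existsP/existsP => [[z' /andP[zc zy]]|[z /andP[zc zy]]].
  have [|z [zx E zy']] := liso_nbr _ yx zy; first lia.
  by exists z; rewrite zy' andbT -(IH k.+1) // -?E //; lia.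
have zx : z \in gball k.+1 x by apply: gball_adj yx _; rewrite adj_sym.
exists (phi z); rewrite (IH k.+1) ?zc //=; last lia.
by rewrite (liso_adj h) //; [apply: gball_mono zx | apply: gball_mono yx]; lia.
Qed.

(** Only an inequality is needed: the converse follows by applying it to the inverse local
    isomorphism. *)
Lemma liso_card_le (P : {set G * G}) (P' : {set G' * G'}) :
  (forall a b, (a, b) \in P -> [/\ a \in gball r x, b \in gball r x & (phi a, phi b) \in P']) ->
  #|P| <= #|P'|.
Proof.
move=> H; rewrite -(card_in_imset (f := fun p => (phi p.1, phi p.2)) (D := mem P)).
  by apply/subset_leq_card/subsetP=> _ /imsetP[[a b] /H[_ _ ab] ->].
move=> [a b] [a1 b1] /H[ax bx _] /H[a1x b1x _] /= [/eqP + /eqP].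
by rewrite !liso_inj // => /eqP-> /eqP->.
Qed.

(** One [j] places the layer within distance [k + j] of [x], the other pays for tracing its vertices
    back to [c]. *)
Lemma liso_inner_le c k j : c \in gball k x -> k + 2 * j <= m ->
  #|inner (layer U c j)| <= #|inner (layer U' (phi c) j)|.
Proof.
move=> cx kj; apply: liso_card_le => a b; rewrite in_inner => /and3P[ac bc ab].
have cx' : c \in gball r x by apply: gball_mono cx; lia.
have in_x u : u \in layer U c j -> u \in gball (k + j) x.
  by move=> /(subsetP (layer_sub_gball _ _ _)); exact: gball_trans.
have ax := in_x _ ac; have bx := in_x _ bc.
have sub : k + j <= r by lia.
split; [exact: gball_mono ax|exact: gball_mono bx|].
rewrite in_inner !(liso_layer (k := k + j)) // ?ac ?bc; try lia.
by rewrite (liso_adj h) //; [exact: gball_mono ax|exact: gball_mono bx].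
Qed.

(** The inequality is strict because outer endpoints of boundary edges lie one step beyond the
    layer. *)
Lemma liso_bdry_le c k j : c \in gball k x -> k + 2 * j < m ->
  #|bdry U (layer U c j)| <= #|bdry U' (layer U' (phi c) j)|.
Proof.
move=> cx kj; apply: liso_card_le => a b; rewrite in_bdry => /and4P[ac bU bc ab].
have cx' : c \in gball r x by apply: gball_mono cx; lia.
have ax : a \in gball (k + j) x.
  by apply: gball_trans cx _; exact: (subsetP (layer_sub_gball _ _ _)) _ ac.
have bx := gball_adj ax ab.
have axr : a \in gball r x by apply: gball_mono ax; lia.
have bxr : b \in gball r x by apply: gball_mono bx; lia.
split=> //.
rewrite in_bdry (liso_layer (k := k + j)) // ?ac //; last lia.
rewrite (liso_layer (k := (k + j).+1)) // ?bc; last lia.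
rewrite (liso_adj h) // ab mU ?bU //; apply: gball_mono bx; lia.
Qed.
End Layers.

Section Carvings.
Variables (G G' : sgraph) (r : nat) (x : G) (x' : G') (phi : G -> G') (psi : G' -> G).
Hypothesis h : local_iso r x x' phi psi.

Lemma liso_gball_eq y c j k : c \in gball r x -> y \in gball k x -> k + j <= r ->
  (phi y \in gball j (phi c)) = (y \in gball j c).
Proof.
move=> cx yx kj; rewrite !gball_layer; apply: (liso_layer h (leqnn r) _ cx yx kj).
by move=> z _; rewrite !in_setT.
Qed.

Lemma liso_lift y k j z' : y \in gball k x -> z' \in gball j (phi y) -> k + j <= r ->
  exists2 z, z \in gball j y & z' = phi z.
Proof.
move=> yx zy kj.
have zx' : z' \in gball r x'.
  by apply: (gball_mono kj); apply: gball_trans zy; apply: liso_gball_le h _ yx; lia.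
exists (psi z'); last by rewrite (lisoVK h).
rewrite gball_sym -(liso_gball_eq (k := k)) //; last exact: (liso_gballV h).
by rewrite (lisoVK h) // gball_sym.
Qed.

Variables (ell : G -> nat) (ell' : G' -> nat).
Hypothesis hell : forall y, y \in gball r x -> ell' (phi y) = ell y.

Lemma liso_lonely c k : c \in gball k x -> k + 2 * R <= r ->
  lonely R ell' (phi c) = lonely R ell c.
Proof.
move=> cx kR; have cxr : c \in gball r x by apply: gball_mono cx; lia.
have in_x y : y \in gball (2 * R) c -> y \in gball r x.
  by move=> yc; apply: (gball_mono kR); exact: gball_trans cx yc.
apply/forall_inP/forall_inP => H y yc.
  have yx := in_x _ yc; have := H (phi y); rewrite !hell // (liso_inj h) //; apply.
  by rewrite gball_sym (liso_gball_eq (k := k)) // gball_sym.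
have [z zc ->] := liso_lift cx yc kR; have zx := in_x _ zc.
by rewrite !hell // (liso_inj h) //; exact: H.
Qed.

Section OneRound.
Variables (m : nat) (U : {set G}) (U' : {set G'}).
Hypotheses (mr : m <= r) (mU : matched x phi m U U').

Lemma liso_good c k j : c \in gball k x -> k + 2 * j < m ->
  good t U' (phi c) j = good t U c j.
Proof.
move=> cx kj; have hV := local_iso_sym h; have mV := matched_sym h mr mU.
have cx' : phi c \in gball k x' by apply: liso_gball_le h _ cx; lia.
have cK : psi (phi c) = c by apply: (lisoK h); apply: gball_mono cx; lia.
have bV := liso_bdry_le hV mr mV cx' kj; have iV := liso_inner_le hV mr mV cx' (ltnW kj).
rewrite cK in bV iV; have b := liso_bdry_le h mr mU cx kj.
have i := liso_inner_le h mr mU cx (ltnW kj).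
by rewrite /good (anti_leq (introT andP (conj b bV))) (anti_leq (introT andP (conj i iV))).
Qed.

Lemma liso_radius c k : c \in gball k x -> k + 2 * R < m ->
  radius t R U' (phi c) = radius t R U c.
Proof.
move=> cx kR; apply: eq_in_find => j; rewrite mem_iota add0n => /andP[_ jR].
by apply: (liso_good cx); lia.
Qed.

Lemma liso_cluster c y k : c \in gball k x -> y \in gball k x -> k + 2 * R + 2 <= m ->
  (phi y \in cluster t R ell' U' (phi c)) = (y \in cluster t R ell U c).
Proof.
move=> cx yx kR; rewrite /cluster (liso_lonely cx); last lia.
rewrite (liso_radius cx); last lia.
rewrite (mU (gball_mono _ cx)); last lia.
case: ifP => _; last by rewrite !inE.
apply: (liso_layer h mr mU _ yx); first by apply: gball_mono cx; lia.
have := radius_leS t R U c; lia.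
Qed.
End OneRound.
End Carvings.

Lemma cluster_gball (G : sgraph) ell (U : {set G}) c : cluster t R ell U c \subset gball R.+1 c.
Proof.
rewrite /cluster; case: ifP => [_|_]; last exact: sub0set.
apply: subset_trans (layer_sub_gball _ _ _) _; apply/subsetP.
by apply: gball_mono; exact: radius_leS.
Qed.

Section Rounds.
Variables (G G' : sgraph) (r : nat) (x : G) (x' : G') (phi : G -> G') (psi : G' -> G).
Hypothesis h : local_iso r x x' phi psi.
Variables (ell : G -> nat) (ell' : G' -> nat).
Hypothesis hell : forall y, y \in gball r x -> ell' (phi y) = ell y.

(** Each round costs [3 * R + 3]: [R.+1] to reach the centre of a cluster containing [y], and
    [2 * R + 2] to determine that cluster. *)
Lemma liso_rest i k : k + i * (3 * R + 3) <= r ->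
  matched x phi k (rest t R ell i) (rest t R ell' i).
Proof.
elim: i k => [|i IH] k ki y yx; first by rewrite !in_setT.
rewrite mulSn in ki.
have mi : matched x phi (k + (3 * R + 3)) (rest t R ell i) (rest t R ell' i) by apply: IH; lia.
rewrite !in_restS (mi _ (gball_mono _ yx)); last lia.
congr (~~ _ && _).
have yx' : y \in gball (k + R.+1) x by apply: gball_mono yx; lia.
apply/bigcupP/bigcupP => -[c /eqP ci yc].
  have := subsetP (cluster_gball _ _ _) _ yc; rewrite gball_sym => cy.
  have [|c1 c1y E] := liso_lift h yx cy; first lia.
  have c1x := gball_trans yx c1y; exists c1.
    by rewrite -hell -?E ?ci //; apply: gball_mono c1x; lia.
  by rewrite E (liso_cluster h hell _ mi c1x) in yc => //; lia.
have := subsetP (cluster_gball _ _ _) _ yc; rewrite gball_sym => cy.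
have cx := gball_trans yx cy; exists (phi c).
  by rewrite hell ?ci //; apply: gball_mono cx; lia.
by rewrite (liso_cluster h hell _ mi cx) //; lia.
Qed.

(** At most [n] rounds precede the cluster containing [y] and [z]; the additional one in [n.+1] pays
    for that cluster itself. *)
Lemma liso_same_imp n k y z : (forall c, ell c < n) ->
  y \in gball k x -> z \in gball k x -> k + n.+1 * (3 * R + 3) <= r ->
  same t R ell y z -> same t R ell' (phi y) (phi z).
Proof.
move=> elln yx zx kn /existsP[c /andP[yc zc]]; apply/existsP; exists (phi c).
have := subsetP (cluster_gball _ _ _) _ yc; rewrite gball_sym => cy.
have cx := gball_trans yx cy; rewrite mulSn in kn.
have cn : ell c * (3 * R + 3) <= n * (3 * R + 3) by rewrite leq_mul2r ltnW ?orbT.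
have Ec : ell' (phi c) = ell c by apply: hell; apply: gball_mono cx; lia.
have mi : matched x phi (k + (3 * R + 3)) (rest t R ell (ell c)) (rest t R ell' (ell c)).
  by apply: liso_rest; lia.
rewrite /final_cluster Ec.
by rewrite !(liso_cluster h hell _ mi cx) ?[_ \in cluster _ _ _ _ _]yc //; try lia;
  [apply: gball_mono zx | apply: gball_mono yx]; lia.
Qed.
End Rounds.

Lemma liso_same (G G' : sgraph) r x x' phi psi (ell : G -> nat) (ell' : G' -> nat) n k y z :
  @local_iso G G' r x x' phi psi ->
  (forall y, y \in gball r x -> ell' (phi y) = ell y) ->
  (forall c, ell c < n) -> (forall c, ell' c < n) ->
  y \in gball k x -> z \in gball k x -> k + n.+1 * (3 * R + 3) <= r ->
  same t R ell' (phi y) (phi z) = same t R ell y z.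
Proof.
move=> h hell elln ell'n yx zx kn; apply/idP/idP; last first.
  exact: (liso_same_imp h hell elln yx zx kn).
have kr : k <= r by lia.
have hell' y' : y' \in gball r x' -> ell (psi y') = ell' y'.
  by move=> y'x; rewrite -hell ?(lisoVK h) //; exact: (liso_gballV h).
have := @liso_same_imp _ _ _ _ _ _ _ (local_iso_sym h) _ _ hell' n k (phi y) (phi z) ell'n
  (liso_gball_le h kr yx) (liso_gball_le h kr zx) kn.
by rewrite !(lisoK h) //; [exact: gball_mono kr _ zx|exact: gball_mono kr _ yx].
Qed.

Definition has_good_radius (G : sgraph) := forall (U : {set G}) c, exists2 k, k <= R & good t U c k.

(** A walk in the component never leaves the ball of radius [2 * R], so each of its edges can be
    transferred by [liso_same]. *)
Lemma liso_component_imp (G G' : sgraph) r x x' phi psi (ell : G -> nat) (ell' : G' -> nat) n y :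
  @local_iso G G' r x x' phi psi -> has_good_radius G ->
  (forall y, y \in gball r x -> ell' (phi y) = ell y) ->
  (forall c, ell c < n) -> (forall c, ell' c < n) ->
  2 * R + n.+1 * (3 * R + 3) <= r ->
  y \in @component (remove_edges (cut t R ell)) x ->
  phi y \in @component (remove_edges (cut t R ell')) x'.
Proof.
move=> h gG hell elln ell'n nr; rewrite !inE => /connectP[p].
elim/last_ind: p y => [|p z IH] y; first by move=> _ ->; rewrite (liso_root h) connect0.
rewrite rcons_path last_rcons => /andP[xp az] ->.
apply: connect_trans (IH _ xp erefl) (connect1 _).
have in_x (u : G) : connect (@adj (remove_edges (cut t R ell))) x u -> u \in gball (2 * R) x.
  by move=> xu; apply: (subsetP (component_gball ell gG x)); rewrite inE.
have px : last x p \in gball (2 * R) x by apply: in_x; apply/connectP; exists p.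
have zx : z \in gball (2 * R) x.
  by apply: in_x; apply/connectP; exists (rcons p z); rewrite ?last_rcons // rcons_path xp.
move: az; rewrite !remove_cut_adj (liso_same h hell elln ell'n px zx nr).
by rewrite (liso_adj h) //; [apply: gball_mono px|apply: gball_mono zx]; lia.
Qed.
End Transfer.
End LocalIso.

(** * From isomorphic balls to isomorphic components *)

Section Isomorphism.

Lemma graph_iso_sym (G H : sgraph) : graph_iso G H -> graph_iso H G.
Proof.
move=> [h [[g hK gK] a]]; exists g; split; first by exists h.
by move=> y z; rewrite -a !gK.
Qed.

Lemma graph_iso_trans (G H K : sgraph) : graph_iso G H -> graph_iso H K -> graph_iso G K.
Proof.
move=> [h [bh ah]] [g [bg ag]]; exists (g \o h); split; first exact: bij_comp.
by move=> y z; rewrite /= ag ah.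
Qed.

Lemma induced_iso (G G' : sgraph) (A : {set G}) (A' : {set G'}) phi psi :
  (forall y, y \in A -> phi y \in A') -> (forall y, y \in A' -> psi y \in A) ->
  {in A, cancel phi psi} -> {in A', cancel psi phi} ->
  {in A &, forall y z, adj (phi y) (phi z) = adj y z} ->
  graph_iso (induced A) (induced A').
Proof.
move=> pA pA' K K' a.
pose h (y : induced A) : induced A' := Sub (phi (val y)) (pA _ (valP y)).
pose g (y : induced A') : induced A := Sub (psi (val y)) (pA' _ (valP y)).
exists h; split.
  exists g => y; apply: val_inj; [exact: K (valP y)|exact: K' (valP y)].
by move=> y z; rewrite /= /induced_adj /=; apply: a; exact: valP.
Qed.

Lemma rooted_iso_sym (A B : rgraph) : rooted_iso A B -> rooted_iso B A.
Proof.
move=> [h [[g hK gK] a r]]; exists g; split; first by exists h.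
  by move=> y z; rewrite -a !gK.
by rewrite -r hK.
Qed.

Lemma rooted_iso_trans (A B C : rgraph) : rooted_iso A B -> rooted_iso B C -> rooted_iso A C.
Proof.
move=> [h [bh ah rh]] [g [bg ag rg]]; exists (g \o h); split; first exact: bij_comp.
  by move=> y z; rewrite /= ag ah.
by rewrite /= rh.
Qed.

Lemma rooted_iso_graph_iso (A B : rgraph) : rooted_iso A B -> graph_iso A B.
Proof. by move=> [h [bh ah _]]; exists h. Qed.

Lemma rooted_ball_local_iso (G G' : sgraph) r (x : G) (x' : G') :
  rooted_iso (rooted_ball r x) (rooted_ball r x') ->
  exists phi psi, local_iso r x x' phi psi.
Proof.
move=> [h [[g hK gK] a hr]].
have gr : g (root (rooted_ball r x')) = root (rooted_ball r x) by rewrite -hr hK.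
(* Vertices outside the ball are sent to the image of the root, which makes the map total. *)
pose phi y := val (h (insubd (root (rooted_ball r x)) y)).
pose psi y := val (g (insubd (root (rooted_ball r x')) y)).
exists phi, psi; rewrite /phi /psi; split=> [||y yx|y yx|y _|y _|y z yx zx].
- rewrite (_ : insubd _ _ = root (rooted_ball r x)) ?hr //.
  by apply: val_inj; rewrite val_insubd gball_center.
- rewrite (_ : insubd _ _ = root (rooted_ball r x')) ?gr //.
  by apply: val_inj; rewrite val_insubd gball_center.
- by rewrite valKd hK val_insubd yx.
- by rewrite valKd gK val_insubd yx.
- exact: valP.
- exact: valP.
- have := a (insubd (root (rooted_ball r x)) y) (insubd (root (rooted_ball r x)) z).
  by rewrite /= /induced_adj !val_insubd yx zx.
Qed.

Lemma liso_component_type (t R : nat) (G G' : sgraph) r x x' phi psi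
    (ell : G -> nat) (ell' : G' -> nat) n (H : sgraph) :
  local_iso r x x' phi psi -> has_good_radius t R G -> has_good_radius t R G' ->
  (forall y, y \in gball r x -> ell' (phi y) = ell y) ->
  (forall c, ell c < n) -> (forall c, ell' c < n) ->
  2 * R + n.+1 * (3 * R + 3) <= r ->
  (x' \in component_type_set (remove_edges (cut t R ell')) H) =
  (x \in component_type_set (remove_edges (cut t R ell)) H).
Proof.
move=> h gG gG' hell elln ell'n nr.
have hell' y' : y' \in gball r x' -> ell (psi y') = ell' y'.
  by move=> y'x; rewrite -hell ?(lisoVK h) //; exact: (liso_gballV h).
have in_x (y : G) : y \in component (G := remove_edges (cut t R ell)) x -> y \in gball (2 * R) x.
  exact: (subsetP (component_gball ell gG x)).
have in_xr (y : G) : y \in component (G := remove_edges (cut t R ell)) x -> y \in gball r x.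
  by move=> /in_x; apply: gball_mono; lia.
have in_x' (y : G') : y \in component (G := remove_edges (cut t R ell')) x' -> y \in gball r x'.
  by move/(subsetP (component_gball ell' gG' x')); apply: gball_mono; lia.
have I : graph_iso (induced (component (G := remove_edges (cut t R ell)) x))
                   (induced (component (G := remove_edges (cut t R ell')) x')).
  apply: (@induced_iso (remove_edges (cut t R ell)) (remove_edges (cut t R ell')) _ _ phi psi).
  - by move=> y; apply: (liso_component_imp h gG hell elln ell'n nr).
  - by move=> y; apply: (liso_component_imp (local_iso_sym h) gG' hell' ell'n elln nr).
  - by move=> y /in_xr; exact: (lisoK h).
  - by move=> y /in_x'; exact: (lisoVK h).
  move=> y z yx zx; rewrite !remove_cut_adj.
  rewrite (liso_same t h hell elln ell'n (in_x _ yx) (in_x _ zx) nr).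
  by rewrite (liso_adj h) //; exact: in_xr.
rewrite !inE; apply/asboolP/asboolP => J; last exact: graph_iso_trans (graph_iso_sym I) J.
exact: graph_iso_trans I J.
Qed.

End Isomorphism.

(** * Finite encoding of rooted graphs of bounded size *)

Section BallTypes.

(** Distances from the root do not increase inside the ball, since the vertices before the end of a
    shortest walk lie in smaller balls. Weak convergence thereby applies to balls of the [G n]. *)
Lemma rooted_ball_is_rd_ball d (G : sgraph) r (x : G) :
  max_degree_le d G -> is_rd_ball r d (rooted_ball r x).
Proof.
move=> Gd.
have toroot k (y : rooted_ball r x) : k <= r -> val y \in gball k x ->
    dist_le k (root (rooted_ball r x)) y.
  elim: k y => [|k IH] y kr.
    by rewrite gball0 => /eqP yx; exists [::]; split=> //=; apply: val_inj.
  rewrite gballS => /orP[/(IH _ (ltnW kr))[p [xp yp pk]]|]; first by exists p; rewrite leqW.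
  case/existsP=> z /andP[zx zy].
  have zr : z \in gball r x by apply: gball_mono (ltnW kr) _ zx.
  have [p [xp pz pk]] := IH (Sub z zr) (ltnW kr) zx.
  exists (rcons p y); rewrite rcons_path last_rcons size_rcons pz xp; split=> //.
have con (y : rooted_ball r x) : dist_le r (root (rooted_ball r x)) y.
  by apply: toroot => //; exact: valP.
have con' (y : rooted_ball r x) : connect adj (root (rooted_ball r x)) y.
  by have [p [xp py _]] := con y; apply/connectP; exists p.
split=> //.
- split; first by apply/card_gt0P; exists (root (rooted_ball r x)).
  move=> y z; apply: connect_trans (con' z).
  by rewrite (sym_connect_sym (@adj_sym (rooted_ball r x))) con'.
- move=> y; apply: leq_trans (Gd (val y)).
  rewrite /degree -(card_imset _ val_inj); apply/subset_leq_card/subsetP => _ /imsetP[z yz ->].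
  by move: yz; rewrite !inE.
Qed.

Definition rcode_type B : finType :=
  ('I_B.+1 * {set 'I_B.+1 * 'I_B.+1} * 'I_B.+1)%type.

Definition rcode_idx B (A : rgraph) (a : A) : 'I_B.+1 := inord (enum_rank a).

(* When [#|A| <= B], records the size, adjacency and root of [A] after the
   vertices are numbered by [enum_rank]. *)
Definition rcode B (A : rgraph) : rcode_type B :=
  (inord #|A|,
   [set (rcode_idx B p.1, rcode_idx B p.2) | p : A * A & adj p.1 p.2],
   rcode_idx B (root A)).

Lemma rcode_idxE B (A : rgraph) (a : A) : #|A| <= B -> rcode_idx B a = enum_rank a :> nat.
Proof. by move=> AB; rewrite inordK // ltnS (leq_trans (ltnW (ltn_ord _))). Qed.

Lemma rcode_idx_inj B (A : rgraph) : #|A| <= B -> injective (@rcode_idx B A).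
Proof.
by move=> AB a b /(congr1 val); rewrite /= !rcode_idxE // => /val_inj/enum_rank_inj.
Qed.

Lemma rcode_adj B (A : rgraph) (a b : A) : #|A| <= B ->
  ((rcode_idx B a, rcode_idx B b) \in (rcode B A).1.2) = adj a b.
Proof.
move=> AB; apply/imsetP/idP => [[[a1 b1]]|ab]; last by exists (a, b); rewrite ?inE.
by rewrite inE /= => ab [/(rcode_idx_inj AB)-> /(rcode_idx_inj AB)->].
Qed.

(** Matching the two enumerations gives the isomorphism. The code depends on the enumeration, so
    isomorphic graphs may have different codes. *)
Lemma rcode_iso B (A A' : rgraph) : #|A| <= B -> #|A'| <= B ->
  rcode B A = rcode B A' -> rooted_iso A A'.
Proof.
move=> AB A'B E.
have cE : #|A| = #|A'|.
  by have := congr1 (fun c : rcode_type B => val c.1.1) E; rewrite /= !inordK.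
pose h (a : A) : A' := enum_val (cast_ord cE (enum_rank a)).
pose g (a : A') : A := enum_val (cast_ord (esym cE) (enum_rank a)).
have hE a : rcode_idx B (h a) = rcode_idx B a.
  by apply: ord_inj; rewrite !rcode_idxE // /h enum_valK.
exists h; split.
- by exists g => a; rewrite /h /g enum_valK ?cast_ordK ?cast_ordKV enum_rankK.
- by move=> a b; rewrite -(rcode_adj _ _ A'B) !hE -E rcode_adj.
- apply: (rcode_idx_inj A'B); rewrite hE.
  exact: (congr1 (fun c : rcode_type B => c.2) E).
Qed.

End BallTypes.

(** * Averages over uniformly random labelings *)

Section Labelings.
Local Open Scope ring_scope.

Section Swap.
Variables (V V' T : finType) (A : {set V}) (A' : {set V'}) (phi : V -> V') (psi : V' -> V).
Hypotheses (phiA : forall y, y \in A -> phi y \in A')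
  (psiA : forall y, y \in A' -> psi y \in A)
  (phiK : {in A, cancel phi psi}) (psiK : {in A', cancel psi phi}).

(* Exchanging the labels on [A] with those on [A'] preserves the uniform measure on
   pairs of labelings; it transports expectations along [phi] and, taking
   [phi = id], decouples functions depending on disjoint sets of labels. *)
Definition swap (p : {ffun V -> T} * {ffun V' -> T}) : {ffun V -> T} * {ffun V' -> T} :=
  ([ffun y => if y \in A then p.2 (phi y) else p.1 y],
   [ffun y => if y \in A' then p.1 (psi y) else p.2 y]).

Lemma swapK : involutive swap.
Proof.
move=> [l l']; congr (_, _); apply/ffunP => y; rewrite ffunE /=; case: ifP => yA.
- by rewrite ffunE phiA // phiK.
- by rewrite ffunE yA.
- by rewrite ffunE psiA // psiK.
- by rewrite ffunE yA.
Qed.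

(** Equality of two means, with denominators cleared: both sides are sums over pairs of labelings,
    and [swap] turns one into the other. *)
Lemma sum_ffun_transfer (M : nmodType) (g : {ffun V -> T} -> M) (g' : {ffun V' -> T} -> M) :
  (forall (l : {ffun V -> T}) (l' : {ffun V' -> T}), (forall y, y \in A -> l' (phi y) = l y) -> g' l' = g l) ->
  (\sum_l g l) *+ #|{ffun V' -> T}| = (\sum_l g' l) *+ #|{ffun V -> T}|.
Proof.
move=> gg'.
have -> : (\sum_l g l) *+ #|{ffun V' -> T}| = \sum_(p : {ffun V -> T} * {ffun V' -> T}) g p.1.
  by rewrite -(pair_bigA _ (fun l _ => g l)) /= -sumrMnl; apply: eq_bigr => l _; rewrite sumr_const.
have -> : (\sum_l g' l) *+ #|{ffun V -> T}| = \sum_(p : {ffun V -> T} * {ffun V' -> T}) g' p.2.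
  by rewrite -(pair_bigA _ (fun _ l => g' l)) /= sumr_const.
rewrite (reindex_inj (inv_inj swapK)); apply: eq_bigr => -[l l'] _ /=.
by symmetry; apply: gg' => y yA; rewrite ffunE yA.
Qed.
End Swap.

(** Independence of [g] and [h]: swapping the labels on [A] turns [g l * h l'] into
    [g l' * h l']. *)
Lemma sum_ffun_indep (V T : finType) (A : {set V}) (M : pzRingType) (g h : {ffun V -> T} -> M) :
  (forall l l' : {ffun V -> T}, (forall y, y \in A -> l' y = l y) -> g l' = g l) ->
  (forall l l' : {ffun V -> T}, (forall y, y \notin A -> l' y = l y) -> h l' = h l) ->
  (\sum_l g l) * (\sum_l h l) = (\sum_l g l * h l) *+ #|{ffun V -> T}|.
Proof.
move=> gA hA; rewrite big_distrlr /=.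
rewrite (pair_bigA _ (fun l l' => g l * h l')) /=.
rewrite (reindex_inj (inv_inj (@swapK V V T A A id id _ _ _ _))) //=.
rewrite (eq_bigr (fun p => g p.2 * h p.2)); last first.
  by move=> [l l'] _; congr (_ * _); [apply: gA|apply: hA] => y yA; rewrite ffunE ?yA ?(negbTE yA).
by rewrite -(pair_bigA _ (fun _ l => g l * h l)) /= sumr_const.
Qed.

Section Mean.
Variables (R : realType) (V T : finType).
Hypothesis T_gt0 : (0 < #|T|)%N.
Implicit Types g : {ffun V -> T} -> R.

Definition mean g := (\sum_l g l) / #|{ffun V -> T}|%:R.

Lemma card_labelings_gt0 : 0 < #|{ffun V -> T}|%:R :> R.
Proof. by rewrite ltr0n card_ffun expn_gt0 T_gt0. Qed.

Lemma sum_centered g : \sum_l (g l - mean g) = 0.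
Proof.
rewrite sumrB sumr_const -mulr_natr divfK ?subrr //.
by rewrite gt_eqF // card_labelings_gt0.
Qed.

Lemma mean_sum (I : finType) (g : I -> {ffun V -> T} -> R) :
  mean (fun l => \sum_i g i l) = \sum_i mean (g i).
Proof. by rewrite /mean exchange_big /= mulr_suml. Qed.

Lemma mean_01 g : (forall l, 0 <= g l <= 1) -> 0 <= mean g <= 1.
Proof.
move=> g01; rewrite /mean divr_ge0 ?ler0n ?sumr_ge0 //=; last by move=> l _; case/andP: (g01 l).
rewrite ler_pdivrMr ?card_labelings_gt0 // mul1r -sum1_card natr_sum.
by apply: ler_sum => l _; case/andP: (g01 l).
Qed.

(* Chebyshev-style bound: [g x] only depends on the labels in [dep x], so it is
   uncorrelated with all but [F] of the other variables. *)
Lemma variance_le (g : V -> {ffun V -> T} -> R) (dep near : V -> {set V}) (F : nat) :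
  (forall x l, 0 <= g x l <= 1) ->
  (forall x (l l' : {ffun V -> T}), (forall y, y \in dep x -> l' y = l y) -> g x l' = g x l) ->
  (forall x y, y \notin near x -> [disjoint dep x & dep y]) ->
  (forall x, (#|near x| <= F)%N) ->
  \sum_l (\sum_x g x l - mean (fun l => \sum_x g x l)) ^+ 2
    <= #|{ffun V -> T}|%:R * (#|V| * F)%:R.
Proof.
move=> g01 gdep disj nearF.
pose c x l := g x l - mean (g x).
have cE l : \sum_x g x l - mean (fun l => \sum_x g x l) = \sum_x c x l.
  by rewrite mean_sum -sumrB.
under eq_bigr do rewrite cE expr2 big_distrlr /=.
rewrite exchange_big /=; under eq_bigr do rewrite exchange_big /=.
have -> : #|{ffun V -> T}|%:R * (#|V| * F)%:R = \sum_(x : V) #|{ffun V -> T}|%:R * F%:R :> R.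
  by rewrite sumr_const -[RHS]mulr_natr natrM mulrCA [RHS]mulrC.
apply: ler_sum => x _.
(* For [y] outside [near x] the covariance factors into two sums of centered variables, which
   vanish; each remaining product is at most 1 in absolute value. *)
rewrite (bigID (mem (near x))) /= [X in _ + X]big1 ?addr0; last first.
  move=> y yx; have dxy := disj _ _ yx.
  have : (\sum_l c x l) * (\sum_l c y l) = (\sum_l c x l * c y l) *+ #|{ffun V -> T}|.
    apply: (@sum_ffun_indep _ _ (dep x)) => l l' e; congr (_ - _); first exact: gdep.
    by apply: gdep => z zy; apply: e; rewrite (disjointFl dxy).
  rewrite sum_centered mul0r => /esym/eqP; rewrite mulrn_eq0 => /orP[|/eqP//].
  by rewrite eqn0Ngt card_ffun expn_gt0 T_gt0.
have c1 z l : `|c z l| <= 1.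
  have /andP[a b] := g01 z l; have /andP[a' b'] := mean_01 (g01 z).
  by rewrite ler_norml /c; apply/andP; split; lra.
apply: (@le_trans _ _ (\sum_(y in near x) #|{ffun V -> T}|%:R)).
  apply: ler_sum => y _; rewrite -sum1_card natr_sum; apply: ler_sum => l _.
  by apply: le_trans (ler_norm _) _; rewrite normrM mulr_ile1.
by rewrite sumr_const -[leLHS]mulr_natr ler_wpM2l ?ler0n // ler_nat.
Qed.

Lemma exists_le_average g (a : R) :
  \sum_l g l <= #|{ffun V -> T}|%:R * a -> exists l, g l <= a.
Proof.
move=> sg; apply: contrapT => H.
have gt l : a < g l by rewrite ltNge; apply/negP => ga; apply: H; exists l.
have /card_gt0P[t0 _] := T_gt0; pose l0 : {ffun V -> T} := [ffun=> t0].
have : \sum_l (g l - a) <= 0.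
  by rewrite sumrB sumr_const subr_le0 -(mulr_natl a).
by rewrite leNgt (bigD1 l0) //= ltr_pwDl ?subr_gt0 // sumr_ge0 // => l _; rewrite subr_ge0 ltW.
Qed.

(** Some labeling makes [a / A + b / B] at most its average bound 2. The case [A = 0], which arises
    for graphs without edges, is separate: there [a] vanishes identically. *)
Lemma exists_simultaneous (a b : {ffun V -> T} -> R) (A B : R) :
  (forall l, 0 <= a l) -> (forall l, 0 <= b l) -> 0 < B ->
  \sum_l a l <= #|{ffun V -> T}|%:R * A -> \sum_l b l <= #|{ffun V -> T}|%:R * B ->
  exists l, a l <= 2 * A /\ b l <= 2 * B.
Proof.
move=> a0 b0 B0 sa sb; have N0 := card_labelings_gt0.
have A0 : 0 <= A by rewrite -(pmulr_rge0 _ N0); apply: le_trans sa; exact: sumr_ge0.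
move: A0; rewrite le_eqVlt => /orP[/eqP A0|A0].
  have az l : a l <= 0.
    rewrite -A0 mulr0 in sa; apply: le_trans sa.
    by rewrite (bigD1 l) //= lerDl sumr_ge0.
  have [l bl] := exists_le_average sb; exists l; rewrite -A0 mulr0; split; first exact: az.
  by apply: le_trans bl _; lra.
have : \sum_l (a l / A + b l / B) <= #|{ffun V -> T}|%:R * 2.
  rewrite big_split /= -!mulr_suml mulrDr mulr1.
  by apply: lerD; rewrite ler_pdivrMr.
move=> /exists_le_average[l ab]; exists l.
have aA : 0 <= a l / A by rewrite divr_ge0 // ltW.
have bB : 0 <= b l / B by rewrite divr_ge0 // ltW.
by rewrite -!ler_pdivrMr //; split; lra.
Qed.
End Mean.

End Labelings.

(** * Expected number of crowded vertices *)

Section Counting.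

Lemma card_inner_edges (G : sgraph) : #|inner [set: G]| <= 2 * #|edges G|.
Proof.
rewrite -sum1_card (partition_big (fun p => [set p.1; p.2]) (mem (edges G))) /=; last first.
  by move=> [a b]; rewrite in_inner => /and3P[_ _ ab]; apply: imset_f; rewrite inE.
rewrite mulnC -sum_nat_const; apply: leq_sum => _ /imsetP[[a b] _ ->] /=.
rewrite sum1dep_card; apply: leq_trans (_ : #|[set (a, b); (b, a)]| <= 2).
  apply/subset_leq_card/subsetP => -[u v]; rewrite !inE /= => /andP[_ /eqP].
  by case/set2_eq=> -[-> ->]; rewrite !xpair_eqE !eqxx ?orbT.
by rewrite cards2; case: (_ == _).
Qed.

(** Shifting the label of [x] cyclically by [a] shows that the events [l x + a = l y] are equally
    likely; these [M.+1] events partition all labelings. *)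
Lemma card_label_collision (V : finType) M (x y : V) : x != y ->
  #|[set l : {ffun V -> 'I_M.+1} | l x == l y]| * M.+1 = #|{ffun V -> 'I_M.+1}|.
Proof.
rewrite eq_sym => /negbTE xy.
pose shift (a : 'I_M.+1) (l : {ffun V -> 'I_M.+1}) : {ffun V -> 'I_M.+1} :=
  [ffun v => if v == x then (l v + a)%R else l v].
have shift_inj a : injective (shift a).
  move=> l l' /ffunP E; apply/ffunP => v; have := E v; rewrite !ffunE; case: ifP => // _.
  exact: addIr.
have E a : #|[set l : {ffun V -> 'I_M.+1} | l x == l y]| =
           #|[set l : {ffun V -> 'I_M.+1} | (l x + a)%R == l y]|.
  rewrite -!sum1dep_card (reindex_inj (shift_inj a)) /=; apply: eq_bigl => l.
  by rewrite !ffunE eqxx xy.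
transitivity (\sum_(a : 'I_M.+1) #|[set l : {ffun V -> 'I_M.+1} | (l x + a)%R == l y]|).
  by under eq_bigr do rewrite -E; rewrite sum_nat_const card_ord mulnC.
under eq_bigr do rewrite -sum1dep_card.
rewrite (exchange_big_dep xpredT) //= -sum1_card; apply: eq_bigr => l _.
rewrite (big_pred1 (l y - l x)%R) // => a /=.
by rewrite addrC eq_sym -subr_eq eq_sym.
Qed.

Lemma gball_isolated (G : sgraph) r (x : G) : degree x = 0 -> gball r x = [set x].
Proof.
move=> dx; elim: r => [|r IH]; apply/setP => y; first by rewrite gball0 inE.
rewrite gballS IH; apply/orP/idP => [[//|]|->]; last by left.
case/existsP=> z /andP[/set1P-> xy]; move/eqP: dx; rewrite cards_eq0 => /eqP/setP/(_ y).
by rewrite !inE xy.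
Qed.

Lemma sum_degree (G : sgraph) : \sum_(x : G) degree x = #|inner [set: G]|.
Proof.
rewrite -sum1dep_card (eq_bigl (fun p : G * G => xpredT p.1 && adj p.1 p.2)); last first.
  by move=> [a b]; rewrite !inE.
rewrite -(pair_big_dep xpredT (fun x y : G => adj x y) (fun _ _ => 1)) /=.
by apply: eq_bigr => x _; rewrite sum1dep_card.
Qed.

(** A union bound over the ball around each vertex. Isolated vertices are never crowded, so a factor
    [degree x] may be inserted; this yields a bound by the number of edges rather than vertices. *)
Lemma sum_card_crowded (G : sgraph) R M F : (forall x : G, #|gball (2 * R) x| <= F) ->
  (\sum_(l : {ffun G -> 'I_M.+1}) #|crowded R (fun v => l v : nat)|) * M.+1 <=
  #|{ffun G -> 'I_M.+1}| * (2 * #|edges G| * F).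
Proof.
move=> GF; set N := #|{ffun G -> 'I_M.+1}|.
have coll (x : G) : (\sum_(l : {ffun G -> 'I_M.+1} | ~~ lonely R (fun v => l v : nat) x) 1) * M.+1
    <= degree x * (F * N).
  have [/gball_isolated dx|d_gt0] := posnP (degree x).
    rewrite big_pred0 // => l; apply/negbTE; rewrite negbK; apply/forall_inP => y.
    by rewrite dx inE => ->; rewrite implybT.
  apply: (@leq_trans (\sum_(y in gball (2 * R) x | y != x) N)); last first.
    apply: (@leq_trans (F * N)); last by rewrite -{1}(mul1n (F * N)) leq_mul2r d_gt0 orbT.
    rewrite big_mkcondr /=.
    apply: (@leq_trans (\sum_(y in gball (2 * R) x) N)).
      by apply: leq_sum => y _; case: ifP.
    by rewrite sum_nat_const leq_mul2r GF orbT.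
  rewrite (eq_bigr (fun y => #|[set l : {ffun G -> 'I_M.+1} | l y == l x]| * M.+1)); last first.
    by move=> y /andP[_ yx]; rewrite card_label_collision.
  rewrite -big_distrl leq_mul2r; apply/orP; right.
  under [leqRHS]eq_bigr do rewrite -sum1dep_card.
  rewrite (exchange_big_dep xpredT) //= big_mkcond /=; apply: leq_sum => l _.
  case: ifP => //; rewrite /lonely negb_forall => /existsP[y].
  rewrite !negb_imply => /and3P[yx lyx nyx].
  by rewrite (bigD1 y) //= yx nyx.
under eq_bigr do rewrite -sum1dep_card.
rewrite (exchange_big_dep xpredT) //= big_distrl /=.
apply: leq_trans (leq_sum _ (fun x _ => coll x)) _.
rewrite -big_distrl /= sum_degree [leqRHS]mulnC -mulnA leq_mul2r card_inner_edges orbT //.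
Qed.
End Counting.

(** * Choice of the radius and convergence of type averages *)

Section Asymptotics.
Local Open Scope ring_scope.
Variable R : realType.

Lemma bernoulli_ineq (h : R) n : 0 <= h -> 1 + n%:R * h <= (1 + h) ^+ n.
Proof.
move=> h0; elim: n => [|n IH]; first by rewrite mul0r addr0 expr0.
have nh : 0 <= n%:R * h * h by rewrite !mulr_ge0.
rewrite exprS; apply: le_trans (_ : (1 + h) * (1 + n%:R * h) <= _); last first.
  by rewrite ler_wpM2l // addr_ge0.
rewrite -natr1; lra.
Qed.

Lemma subexponential_radius f d t : subexponential R f -> (0 < t)%N ->
  exists2 r, (0 < r)%N & (t ^ r * (d * f r.+1) < t.+1 ^ r)%N.
Proof.
move=> hf t0; have t0' : 0 < t%:R :> R by rewrite ltr0n.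
have half0 : 0 < 2^-1 :> R by rewrite invr_gt0.
(* Growth rate [1 + 1/(2t)] gives [t ^ r * (d * f r.+1) <= D * q ^ r]. As [t + 1 = (1 + h) * q], it
   suffices that [D < (1 + h) ^ r], which Bernoulli's inequality gives once [r > D / h]. *)
pose q : R := t%:R + 2^-1; have q0 : 0 < q by rewrite addr_gt0.
have [|C C0 fC] := hf (2^-1 / t%:R); first by rewrite divr_gt0.
pose h : R := 2^-1 / q; have h0 : 0 < h by rewrite divr_gt0.
pose D : R := d%:R * C * (1 + 2^-1 / t%:R).
have D0 : 0 <= D by rewrite !mulr_ge0 ?ler0n ?ltW // addr_gt0 // divr_gt0.
pose r := (Num.truncn (D / h)).+1; exists r => //.
have rD : D < r%:R * h by rewrite -ltr_pdivrMr //; exact: truncnS_gt.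
rewrite -(ltr_nat R) !natrM !natrX -natr1.
have -> : t%:R + 1 = (1 + h) * q :> R by rewrite mulrDl mul1r divfK ?gt_eqF // /q; lra.
rewrite exprMn; apply: le_lt_trans (_ : D * q ^+ r < _); last first.
  rewrite ltr_pM2r ?exprn_gt0 //; apply: lt_le_trans rD _.
  apply: le_trans (bernoulli_ineq r (ltW h0)); by rewrite lerDr.
have qE : q = t%:R * (1 + 2^-1 / t%:R) by rewrite mulrDr mulr1 mulrCA divff ?gt_eqF // mulr1.
rewrite qE exprMn [leRHS]mulrCA; apply: ler_wpM2l; first by rewrite exprn_ge0 // ltW.
rewrite /D -!mulrA; apply: ler_wpM2l; first exact: ler0n.
by rewrite -exprS; exact: fC.
Qed.

Lemma cvg_sum_seq (I : Type) (s : seq I) (u : I -> nat -> R) :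
  (forall i, exists l : R, ((u i) @ \oo --> l)%classic) ->
  exists l : R, ((fun n => \sum_(i <- s) u i n) @ \oo --> l)%classic.
Proof.
move=> H; elim: s => [|i s [l IH]].
  by exists 0; under eq_fun do rewrite big_nil; exact: cvg_cst.
have [k ik] := H i; exists (k + l); under eq_fun do rewrite big_cons.
exact: cvgD.
Qed.

Variables (d : nat) (f : nat -> nat) (G : nat -> sgraph).
Hypotheses (hG : forall n, in_Graph_df d f (G n)) (hconv : weakly_convergent R d G).

(** Grouping vertices by ball type makes the average a finite linear combination of ball
    frequencies, with coefficients independent of [n]. *)
Lemma type_average_cvg r (mu : forall n, G n -> R) : (0 < r)%N ->
  (forall n m (x : G n) (y : G m),
    rooted_iso (rooted_ball r x) (rooted_ball r y) -> mu n x = mu m y) ->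
  exists l : R, ((fun n => (\sum_x mu n x) / #|G n|%:R) @ \oo --> l)%classic.
Proof.
move=> r0 muE; pose C := rcode_type (f r).
pose ball (s : {n & G n}) := rooted_ball r (projT2 s).
have ball_le s : (#|ball s| <= f r)%N.
  by rewrite /ball /= card_sig; exact: (proj2 (hG _)).
(* [al] chooses a representative ball for every code that occurs. *)
have [al alE] : exists al : C -> option {n & G n}, forall s,
    exists2 s', al (rcode (f r) (ball s)) = Some s' & rooted_iso (ball s) (ball s').
  exists (fun c => if pselect (exists s, rcode (f r) (ball s) = c) is left e
            then Some (projT1 (cid e)) else None) => s.
  case: pselect => [e|[]]; last by exists s.
  by exists (projT1 (cid e)) => //; case: cid => s' /= es; apply: (@rcode_iso (f r)).
pose hit c s := if al c is Some s' then `[< rooted_iso (ball s) (ball s') >] else false.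
(* Codes are not isomorphism invariant; the first code whose representative is isomorphic to the
   ball is. *)
pose cls s := [pick c | hit c s].
have cls_hit s c : cls s = Some c -> hit c s.
  by rewrite /cls; case: pickP => // c' h [<-].
have cls_some s : cls s != None.
  rewrite /cls; case: pickP => // /(_ (rcode (f r) (ball s))); rewrite /hit.
  by have [s' -> i] := alE s => /negP[]; apply/asboolP.
have cls_iso s s' : rooted_iso (ball s) (ball s') -> cls s = cls s'.
  move=> i; apply: eq_pick => c; rewrite /hit; case: (al c) => // a.
  by apply/asboolP/asboolP; apply: rooted_iso_trans => //; exact: rooted_iso_sym.
pose w c := if al c is Some s then mu (projT1 s) (projT2 s) else 0.
pose cnt c n := #|[set x : G n | cls (existT _ n x) == Some c]|.
have sumE n : (\sum_x mu n x) / #|G n|%:R = \sum_c w c * ((cnt c n)%:R / #|G n|%:R).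
  transitivity ((\sum_c w c * (cnt c n)%:R) / #|G n|%:R); last first.
    by rewrite mulr_suml; apply: eq_bigr => c _; rewrite mulrA.
  congr (_ / _); pose cl (x : G n) := odflt (rcode (f r) (rooted_ball r x)) (cls (existT _ n x)).
  rewrite (partition_big cl xpredT) //=; apply: eq_bigr => c _.
  have clE x : (cl x == c) = (cls (existT _ n x) == Some c).
    by rewrite /cl; case: (cls _) (cls_some (existT _ n x)).
  rewrite (eq_bigl _ _ clE) (eq_bigr (fun=> w c)); last first.
    move=> x /eqP/cls_hit; rewrite /hit /w; case: (al c) => // s /asboolP; exact: muE.
  by rewrite sumr_const mulr_natr /cnt cardsE.
rewrite (funext sumE); apply: cvg_sum_seq => c.
suff [l cl] : exists l : R, ((fun n => (cnt c n)%:R / #|G n|%:R) @ \oo --> l)%classic.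
  by exists (w c * l); apply: cvgM => //; exact: cvg_cst.
(* A class that never occurs contributes 0; otherwise its frequency is that of the ball of any
   member [s0]. *)
have [[s0 cs0]|none] := pselect (exists s, cls s = Some c); last first.
  exists 0; rewrite (_ : (fun n => _) = fun=> 0); first exact: cvg_cst.
  apply/funext => n; rewrite /cnt (_ : [set x | _] = set0) ?cards0 ?mul0r //.
  apply/setP => x; rewrite !inE; apply/negbTE/eqP => cx; apply: none.
  by exists (existT _ n x).
have [l ll] := (proj2 hconv) r (ball s0) r0 (rooted_ball_is_rd_ball _ _ (proj1 (hG _))).
exists l; rewrite (_ : (fun n => _) = fun n => ball_freq R (G n) r (ball s0)) //.
apply/funext => n; congr (_%:R / _); rewrite /cnt; apply: eq_card => x; rewrite !inE.
apply/eqP/asboolP => [cx|/(@cls_iso (existT _ n x) s0)->//].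
have := cls_hit _ _ cs0; have := cls_hit _ _ cx; rewrite /hit.
by case: (al c) => // s /asboolP i /asboolP/rooted_iso_sym; exact: rooted_iso_trans i.
Qed.
End Asymptotics.

(** * Choice of labelings and proof of the theorem *)

Section Assembly.
Local Open Scope ring_scope.
Variable R : realType.

Section Cutting.
Variables (t r M : nat).

Definition labels (G : sgraph) (l : {ffun G -> 'I_M.+1}) : G -> nat := fun v => l v.

Definition random_cut (G : sgraph) (l : {ffun G -> 'I_M.+1}) := cut t r (labels l).

(** [2 * r] covers a component, and [M.+2] pays for the [M.+1] rounds and one last cluster. *)
Definition locality : nat := 2 * r + M.+2 * (3 * r + 3).

Definition type_count (G : sgraph) (H : sgraph) (l : {ffun G -> 'I_M.+1}) : R :=
  #|component_type_set (remove_edges (random_cut l)) H|%:R.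

Definition type_indicator (G : sgraph) (H : sgraph) (x : G) (l : {ffun G -> 'I_M.+1}) : R :=
  (x \in component_type_set (remove_edges (random_cut l)) H)%:R.

Lemma type_countE (G H : sgraph) :
  @type_count G H = fun l => \sum_x type_indicator H x l.
Proof.
apply/funext => l; rewrite /type_count -sum1_card natr_sum big_mkcond /=.
by apply: eq_bigr => x _; rewrite /type_indicator; case: (x \in _).
Qed.

(** Used between isomorphic balls to equate means, and with the identity to see that the indicator
    depends only on nearby labels. *)
Lemma type_indicator_iso (G G' H : sgraph) (x : G) (x' : G') phi psi
    (l : {ffun G -> 'I_M.+1}) (l' : {ffun G' -> 'I_M.+1}) :
  local_iso locality x x' phi psi -> has_good_radius t r G -> has_good_radius t r G' ->
  (forall y, y \in gball locality x -> l' (phi y) = l y) ->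
  type_indicator H x' l' = type_indicator H x l.
Proof.
move=> h gG gG' ll; rewrite /type_indicator.
rewrite (@liso_component_type t r _ _ _ _ _ _ _ (labels l) (labels l') M.+1 H h) //.
- by move=> y yx; rewrite /labels ll.
- by move=> c; rewrite /labels.
- by move=> c; rewrite /labels.
Qed.

Lemma mean_type_indicator_iso (G G' H : sgraph) (x : G) (x' : G') :
  rooted_iso (rooted_ball locality x) (rooted_ball locality x') ->
  has_good_radius t r G -> has_good_radius t r G' ->
  mean (type_indicator H x) = mean (type_indicator H x').
Proof.
move=> /rooted_ball_local_iso[phi [psi h]] gG gG'; rewrite /mean.
have N0 (V : finType) : #|{ffun V -> 'I_M.+1}|%:R != 0 :> R.
  by rewrite gt_eqF // card_labelings_gt0 // card_ord.
apply/eqP; rewrite eqr_div //; apply/eqP; rewrite !mulr_natr.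
apply: (@sum_ffun_transfer _ _ _ (gball locality x) (gball locality x') phi psi).
- exact: liso_gball h.
- exact: liso_gballV h.
- exact: lisoK h.
- exact: lisoVK h.
- by move=> l l'; exact: type_indicator_iso h gG gG'.
Qed.

(** The squared deviations of all types are added into one quantity [b], so a single averaging
    controls them all. The successor in the bound keeps it positive, as [exists_simultaneous]
    requires. *)
Lemma exists_good_labeling (C : finType) (Hs : C -> sgraph) (G : sgraph) d f (eps : R) :
  in_Graph_df d f G -> has_good_radius t r G -> (0 < t)%N -> (0 < r)%N -> 0 < eps ->
  4 / t%:R <= eps / 2 -> 4 * (d * f (2 * r)%N)%:R / M.+1%:R <= eps / 2 ->
  exists l : {ffun G -> 'I_M.+1},
    #|random_cut l|%:R <= eps * #|edges G|%:R /\
    forall c, (type_count (Hs c) l - mean (@type_count G (Hs c))) ^+ 2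
      <= 2 * (#|C| * (#|G| * f (2 * locality)%N)).+1%:R.
Proof.
move=> [Gd Gf] gG t0 r0 eps0 ht hM; set N := #|{ffun G -> 'I_M.+1}|.
have T0 : (0 < #|'I_M.+1|)%N by rewrite card_ord.
have t0' : 0 < t%:R :> R by rewrite ltr0n.
pose E : R := #|edges G|%:R.
pose b (l : {ffun G -> 'I_M.+1}) := \sum_c (type_count (Hs c) l - mean (@type_count G (Hs c))) ^+ 2.
have sum_a : \sum_(l : {ffun G -> 'I_M.+1}) #|random_cut l|%:R <= N%:R * (eps / 2 * E).
  have cut_le (l : {ffun G -> 'I_M.+1}) : #|random_cut l|%:R <=
      2 / t%:R * E + d%:R * #|crowded r (labels l)|%:R.
    have := card_cut gG Gd (fun c => ltn_ord (l c)).
    rewrite -(ler_nat R) natrD !natrM => /le_trans H.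
    rewrite -(ler_pM2l t0'); apply: le_trans (H (2 * E + t%:R * (d%:R * #|crowded r (labels l)|%:R)) _) _.
      by rewrite lerD2r -natrM ler_nat card_inner_edges.
    by rewrite le_eqVlt; apply/orP; left; apply/eqP; field; rewrite gt_eqF.
  have GF (x : G) : (#|gball (2 * r) x| <= f (2 * r))%N by apply: Gf; rewrite muln_gt0.
  have := sum_card_crowded M GF; rewrite -(ler_nat R) !natrM natr_sum.
  rewrite -ler_pdivlMr ?ltr0n // => coll.
  apply: le_trans (ler_sum _ (fun l _ => cut_le l)) _.
  rewrite big_split /= sumr_const -mulr_sumr -[_ *+ _]mulr_natl.
  have M0 : 0 < M.+1%:R :> R by rewrite ltr0n.
  have := ler_wpM2l (ler0n R d) coll => coll'.
  apply: le_trans (lerD (lexx _) coll') _.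
  rewrite -/N -/E.
  have -> : d%:R * (N%:R * (2 * E * (f (2 * r)%N)%:R) / M.+1%:R) =
    N%:R * (4 * (d * f (2 * r)%N)%:R / M.+1%:R / 2 * E).
    by rewrite natrM; move: M.+1%:R M0 => m m0; field; rewrite gt_eqF.
  have E0 : 0 <= E := ler0n _ _.
  rewrite -mulrDr ler_wpM2l ?ler0n // -mulrDl ler_wpM2r //.
  have -> : 2 / t%:R = 4 / t%:R / 2 :> R by field; rewrite gt_eqF.
  by move: ht hM; move: (4 / t%:R) (4 * _ / _) => u v; lra.
have sum_b : \sum_l b l <= N%:R * (#|C| * (#|G| * f (2 * locality)%N)).+1%:R.
  rewrite exchange_big /=.
  apply: (@le_trans _ _ (\sum_(c : C) N%:R * (#|G| * f (2 * locality)%N)%:R)).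
    apply: ler_sum => c _; rewrite type_countE.
    apply: (@variance_le _ _ _ T0 (@type_indicator G (Hs c)) (@gball G locality)
      (@gball G (2 * locality)) (f (2 * locality)%N)).
    - by move=> x l; rewrite /type_indicator; case: (x \in _); rewrite ?lexx ?ler01.
    - move=> x l l' ll'; exact: (type_indicator_iso _ (local_iso_id _ _) gG gG ll').
    - move=> x y; apply: contraR => /pred0Pn[z /andP[/= zx zy]].
      by rewrite mul2n -addnn; apply: gball_trans zx _; rewrite gball_sym.
    - by move=> x; apply: Gf; rewrite muln_gt0 /locality addn_gt0 !muln_gt0 r0.
  rewrite sumr_const -[leLHS]mulr_natl mulrCA ler_wpM2l ?ler0n //.
  by rewrite -natrM ler_nat leqnSn.
have [l [la lb]] := exists_simultaneous T0 (fun l => ler0n R #|random_cut l|)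
  (fun l => sumr_ge0 _ (fun c _ => sqr_ge0 _)) (ltr0Sn _ _) sum_a sum_b.
exists l; split; first by rewrite /E in la; lra.
move=> c; apply: le_trans lb; rewrite /b (bigD1 c) //= lerDl.
by apply: sumr_ge0 => c' _; exact: sqr_ge0.
Qed.
End Cutting.

(** The hypothesis makes [u n] of order the square root of [V n]. *)
Lemma cvg_of_sqr_le (V : nat -> nat) (u : nat -> R) (a : nat) :
  ((V n @[n --> \oo]) --> \oo)%classic ->
  (forall n, u n ^+ 2 <= a%:R * (V n).+1%:R) ->
  ((fun n => u n / (V n)%:R) @ \oo --> (0 : R))%classic.
Proof.
move=> Voo ua; apply/cvgr0Pnorm_lt => e e0.
pose A := (Num.truncn (2 * a%:R / e ^+ 2)).+1.
have /cvgnyPge/(_ A) := Voo; apply: filterS => n An.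
have V0 : 0 < (V n)%:R :> R by rewrite ltr0n (leq_trans _ An).
have AV : 2 * a%:R / e ^+ 2 < (V n)%:R.
  by apply: lt_le_trans (truncnS_gt _) _; rewrite ler_nat.
rewrite -(@ltr_pXn2r _ 2) ?nnegrE ?normr_ge0 ?ltW //.
rewrite -normrX ger0_norm ?sqr_ge0 // exprMn exprVn ltr_pdivrMr ?exprn_gt0 //.
apply: le_lt_trans (ua n) _.
rewrite ltr_pdivrMr ?exprn_gt0 // in AV.
have V1 : 1 <= (V n)%:R :> R by rewrite ler1n (leq_trans _ An).
apply: le_lt_trans (_ : (2 * a%:R) * (V n)%:R < _).
  by rewrite -natr1; have := ler0n R a; nra.
by rewrite (expr2 (V n)%:R) mulrA ltr_pM2r // [ltRHS]mulrC.
Qed.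
End Assembly.

Local Open Scope ring_scope.

Theorem theorem1 (R : realType) (d : nat) (f : nat -> nat) (G : nat -> sgraph)
    (hd : (2 <= d)%N)
    (hf : subexponential R f)
    (hG : forall n : nat, in_Graph_df d f (G n))
    (hconv : weakly_convergent R d G)
    (eps : R) (heps : 0 < eps) :
  exists (K : nat) (c : sgraph -> R),
    (0 < K)%N /\
    exists S : forall n : nat, {set {set G n}},
      (forall n : nat,
         [/\ S n \subset edges (G n),
             #|S n|%:R <= eps * #|edges (G n)|%:R
           & forall x : remove_edges (S n), (#|component x| <= K)%N]) /\
      (forall H : sgraph,
         connected_graph H -> in_Graph_df d f H -> (#|H| <= K)%N ->
         ((fun n => #|component_type_set (remove_edges (S n)) H|%:R / #|G n|%:R : R)
            @ \oo --> c H)%classic).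
Proof.
(* [t] and then [M] are so large that boundaries and crowded vertices each cost on average at most
   [eps / 4] times the number of edges. *)
pose t := (Num.truncn (8 / eps)).+1; have t0 : (0 < t)%N by [].
have [r r0 hr] := subexponential_radius d hf t0.
pose D : R := (d * f (2 * r)%N)%:R; pose M := Num.truncn (8 * D / eps).
pose K := (f r).+1; pose C := rcode_type K.
have gG n : has_good_radius t r (G n) by move=> U c; exact: exists_good (hG n) hr.
pose code_of (A : rgraph) c := (#|A| <= K)%N /\ rcode K A = c.
(* One graph for each code, so that finitely many types suffice; [G 0] is a dummy for codes that no
   graph has. *)
pose Hs (c : C) : sgraph :=
  if pselect (exists A, code_of A c) is left e then projT1 (cid e) else G 0.
have ht : 4 / t%:R <= eps / 2.
  have := truncnS_gt (8 / eps); rewrite -/t ltr_pdivrMr // ler_pdivrMr ?ltr0n //.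
  by move=> h; lra.
have hM : 4 * D / M.+1%:R <= eps / 2.
  have := truncnS_gt (8 * D / eps); rewrite -/M ltr_pdivrMr // ler_pdivrMr ?ltr0n //.
  by move=> h; lra.
have H1 n := exists_good_labeling Hs (hG n) (gG n) t0 r0 heps ht hM.
pose l n := projT1 (cid (H1 n)).
have l_cut n : #|random_cut t r (l n)|%:R <= eps * #|edges (G n)|%:R.
  by rewrite /l; case: cid => ? [].
have l_dev n c := proj2 (projT2 (cid (H1 n))) c.
pose freq H n : R := #|component_type_set (remove_edges (random_cut t r (l n))) H|%:R / #|G n|%:R.
(* [lim] is total and names the constants for all [H] at once; convergence is proved below for the
   relevant [H]. *)
exists K, (fun H => lim (freq H @ \oo)%classic); split=> //.
exists (fun n => random_cut t r (l n)); split.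
  move=> n; split; [exact: cut_sub|exact: l_cut|move=> x].
  exact: leqW (card_component (labels (l n)) (gG n) x (hG n) r0).
move=> H [H0 _] _ HK; have /card_gt0P[v _] := H0.
suff [k hk] : exists k : R, (freq H @ \oo --> k)%classic by apply: (cvgP k).
(* Codes are for rooted graphs, so an arbitrary vertex [v] of [H] serves as root. *)
pose c := rcode K (RGraph v).
have iso : graph_iso (Hs c) H.
  rewrite /Hs; case: pselect => [e|[]]; last by exists (RGraph v).
  case: cid => A [AK Ac] /=.
  exact: rooted_iso_graph_iso (@rcode_iso K A (RGraph v) AK HK Ac).
have freqE n : freq H n = type_count R t r (Hs c) (l n) / #|G n|%:R.
  congr (_%:R / _); apply: eq_card => x; rewrite !inE.
  by apply/asboolP/asboolP => i; apply: graph_iso_trans i _ => //; exact: graph_iso_sym.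
pose mu n := mean (@type_count R t r M (G n) (Hs c)).
have [k hk] : exists k : R, ((fun n => mu n / #|G n|%:R) @ \oo --> k)%classic.
  have loc0 : (0 < locality r M)%N by rewrite /locality addn_gt0 !muln_gt0 r0.
  have [|k hk] := @type_average_cvg R d f G hG hconv _
    (fun n x => mean (@type_indicator R t r M _ (Hs c) x)) loc0.
    by move=> n m x y i; exact: (mean_type_indicator_iso _ _ i (gG n) (gG m)).
  exists k; have E : (fun n => mu n / #|G n|%:R) = fun n =>
      (\sum_x mean (@type_indicator R t r M (G n) (Hs c) x)) / #|G n|%:R.
    by apply/funext => n; rewrite /mu type_countE mean_sum.
  by rewrite E.
(* The frequency is the normalized mean, which converges, plus a normalized deviation that tends to
   0 by the variance bound. *)
exists k; pose dev n := type_count R t r (Hs c) (l n) - mu n.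
have dev0 : ((fun n => dev n / #|G n|%:R) @ \oo --> (0 : R))%classic.
  apply: (@cvg_of_sqr_le _ _ _ (2 * (#|C| * f (2 * locality r M) + 1))%N (proj1 hconv)) => n.
  apply: le_trans (l_dev n c) _; rewrite natrM -mulrA ler_wpM2l // -natrM ler_nat.
  by rewrite addn1 mulSn mulnS; nia.
rewrite (_ : freq H = fun n => mu n / #|G n|%:R + dev n / #|G n|%:R).
  by rewrite -[k]addr0; exact: cvgD.
by apply/funext => n; rewrite freqE -mulrDl addrC subrK.
Qed.
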